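(* For every integer $m\geq 2$, with $\omega_m=e^{2\pi i/m}$, $$\zeta(m)=\sum_{n=1}^{\infty}\frac{m(-1)^{n-1}\,\Gamma(1-\omega_m n)\,\Gamma(1-\omega_m^2 n)\cdots\Gamma(1-\omega_m^{m-1}n)}{n!\,n^m}.$$
   Context: $\Gamma$ is Euler's gamma function and $\zeta$ is the Riemann zeta function. *)

(* Defs.v *)
From Stdlib Require Import Reals Factorial.
From Coquelicot Require Import Coquelicot.

Open Scope R_scope.

Definition Cexp (z : C) : C := (exp (Re z) * (cos (Im z), sin (Im z)))%C.

(* x ^ z for a positive real base x, with the real logarithm of x. *)
Definition Rpow_C (x : R) (z : C) : C := Cexp (z * ln x)%C.

(* Product of f 0, ..., f (n - 1). *)
Fixpoint Cprod (f : nat -> C) (n : nat) : C :=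
  match n with
  | O => 1%C
  | S p => (Cprod f p * f p)%C
  end.

(* Only meaningful for convergent sequences, as Lim_seq is. *)
Definition CLim_seq (u : nat -> C) : C :=
  (real (Lim_seq (fun n => Re (u n))), real (Lim_seq (fun n => Im (u n)))).

(* Euler's definition of the gamma function, in Gauss's form:
     Gamma z = lim_n  n! n^z / (z (z + 1) ... (z + n)),
   valid on the whole domain of Gamma, i.e. for every complex z that is not
   one of the poles 0, -1, -2, ... The integral of t^(z - 1) exp (- t) would
   only cover Re z > 0. *)
Definition Gamma (z : C) : C :=
  CLim_seq (fun n =>
    (INR (fact n) * Rpow_C (INR n) z
     / Cprod (fun j => z + INR j) (S n))%C).

(* The Dirichlet series of the Riemann zeta function, sum over n >= 1 of n^(-s);
   this is zeta on the half-plane Re s > 1 only. *)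
Definition zeta (s : C) : C :=
  CLim_seq (sum_n (G := C_AbelianMonoid) (fun i => Rpow_C (INR (S i)) (- s)%C)).

Definition omega (m : nat) : C := Cexp (2 * PI * Ci / INR m)%C.

(* Main.v *)
Require Import Defs.
From Stdlib Require Import Reals Factorial Lra Lia.
From Coquelicot Require Import Coquelicot.

Open Scope R_scope.

(** The identity is a limit of a partial fraction expansion.  With [a_j = j^m],
    expanding [prod_(j<=N) a_j / (a_j - y)] in simple fractions and comparing
    the coefficients of [y] gives
      [sum_(n<=N) r_(n,N) / n^m = sum_(j<=N) 1 / j^m],
      [r_(n,N) = prod_(j<=N, j<>n) j^m / (j^m - n^m)].
    Since [j^m - n^m] is the product of the [j - w^k n], [w = e^(2 pi i / m)],
    Gauss's formula turns the limit of [r_(n,N)] as [N -> oo] into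
    [m (-1)^(n-1) / n!] times the product of the [Gamma (1 - w^k n)], [0 < k < m].
    Each factor of [|r_(n,N)|] decreases with [m], and for [m = 2] one has
    [|r_(n,N)| = 2 N!^2 / ((N-n)! (N+n)!) <= 2], so the sum is dominated by
    [2 / n^m] and the limit may be taken term by term. *)

(** * Finite real products, with one factor left out *)

Fixpoint Rprod (f : nat -> R) (n : nat) : R :=
  match n with
  | O => 1
  | S p => Rprod f p * f p
  end.

Lemma Rprod_ext (f g : nat -> R) (n : nat) :
  (forall j, (j < n)%nat -> f j = g j) -> Rprod f n = Rprod g n.
Proof.
  induction n as [|n IH]; intros H; simpl; [easy|].
  rewrite IH, H; auto.
Qed.

Lemma Rprod_mult (f g : nat -> R) (n : nat) :
  Rprod (fun j => f j * g j) n = Rprod f n * Rprod g n.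
Proof. induction n as [|n IH]; simpl; [ring|rewrite IH; ring]. Qed.

Lemma Rprod_pos (f : nat -> R) (n : nat) :
  (forall j, (j < n)%nat -> 0 < f j) -> 0 < Rprod f n.
Proof.
  induction n as [|n IH]; intros H; simpl; [lra|].
  apply Rmult_lt_0_compat; auto.
Qed.

Lemma Rprod_abs_le (f g : nat -> R) (n : nat) :
  (forall j, (j < n)%nat -> Rabs (f j) <= Rabs (g j)) ->
  Rabs (Rprod f n) <= Rabs (Rprod g n).
Proof.
  induction n as [|n IH]; intros H; simpl; [lra|].
  rewrite !Rabs_mult.
  apply Rmult_le_compat; try apply Rabs_pos; auto.
Qed.

Lemma Rprod_inv (f : nat -> R) (n : nat) :
  Rprod (fun j => / f j) n = / Rprod f n.
Proof.
  induction n as [|n IH]; simpl; [field|].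
  now rewrite IH, Rinv_mult.
Qed.

Lemma Rprod_pow (f : nat -> R) (p n : nat) :
  Rprod (fun j => f j ^ p) n = Rprod f n ^ p.
Proof.
  induction n as [|n IH]; simpl; [now rewrite pow1|].
  now rewrite IH, Rpow_mult_distr.
Qed.

Lemma Rprod_INR_S (n : nat) : Rprod (fun j => INR (S j)) n = INR (fact n).
Proof.
  induction n as [|n IH]; [reflexivity|].
  cbn [Rprod]; rewrite IH.
  change (fact (S n)) with (S n * fact n)%nat.
  rewrite mult_INR; ring.
Qed.

(** A factor 1 in place of the one at [n] turns a product over [j <> n] into a plain [Rprod], even
    when [g n] would divide by zero. *)
Definition puncture (g : nat -> R) (n j : nat) : R :=
  if Nat.eqb j n then 1 else g j.

Lemma puncture_at (g : nat -> R) (n : nat) : puncture g n n = 1.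
Proof. unfold puncture; now rewrite Nat.eqb_refl. Qed.

Lemma puncture_neq (g : nat -> R) (n j : nat) :
  j <> n -> puncture g n j = g j.
Proof. intros H; unfold puncture; now apply Nat.eqb_neq in H as ->. Qed.

Lemma Rprod_puncture_out (g : nat -> R) (n N : nat) :
  (N <= n)%nat -> Rprod (puncture g n) N = Rprod g N.
Proof.
  intros H; apply Rprod_ext; intros j Hj; apply puncture_neq; lia.
Qed.

Lemma Rprod_puncture (g : nat -> R) (n N : nat) :
  (n < N)%nat -> Rprod g N = g n * Rprod (puncture g n) N.
Proof.
  induction N as [|N IH]; intros H; [lia|].
  simpl; destruct (Nat.eq_dec N n) as [->|HN].
  - rewrite puncture_at, Rprod_puncture_out by lia; ring.
  - rewrite puncture_neq, IH by lia; ring.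
Qed.

(** * Partial fractions *)

(** Up to the factor [- a n], for distinct nodes and [n < N], the residue at [y = a n] of the
    product over [j < N] of [a j / (a j - y)]. *)
Definition residue (a : nat -> R) (n N : nat) : R :=
  Rprod (puncture (fun j => a j / (a j - a n)) n) N.

Lemma residue_S (a : nat -> R) (n N : nat) :
  (n < N)%nat -> residue a n (S N) = residue a n N * (a N / (a N - a n)).
Proof.
  intros H; unfold residue; simpl; now rewrite puncture_neq by lia.
Qed.

Lemma residue_last (a : nat -> R) (N : nat) :
  residue a N (S N) = Rprod (fun j => a j / (a j - a N)) N.
Proof.
  unfold residue; simpl.
  rewrite puncture_at, Rprod_puncture_out by lia; ring.
Qed.

Lemma sum_n_succ (u : nat -> R) (N : nat) :
  sum_n u (S N) = sum_n u N + u (S N).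
Proof. exact (sum_Sn u N). Qed.

Lemma sum_n_eq (u v : nat -> R) (N : nat) :
  (forall n, (n <= N)%nat -> u n = v n) -> sum_n u N = sum_n v N :> R.
Proof. exact (sum_n_ext_loc u v N). Qed.

Lemma sum_n_lin (u v : nat -> R) (c d : R) (N : nat) :
  sum_n (fun n => c * u n + d * v n) N = c * sum_n u N + d * sum_n v N.
Proof.
  induction N as [|N IH]; [now rewrite !sum_O|].
  rewrite !sum_n_succ, IH; simpl; ring.
Qed.

(** Induction on [N] for all [y] at once. With [b = a (S N)], each old term splits by [1/((b -
    a_n)(a_n - y)) = (1/(a_n - y) - 1/(a_n - b))/(b - y)]. The induction hypothesis is then used at
    [y], which gives the product, and at [b], which cancels the term of the new pole. *)
Lemma partial_fractions (a : nat -> R) (N : nat) (y : R) :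
  (forall i j, i <> j -> a i <> a j) ->
  (forall j, (j <= N)%nat -> a j <> y) ->
  sum_n (fun n => a n * residue a n (S N) / (a n - y)) N
  = Rprod (fun j => a j / (a j - y)) (S N) :> R.
Proof.
  intros Ha; revert y; induction N as [|N IH]; intros y Hy.
  - rewrite sum_O, residue_last; simpl.
    field; apply Rminus_eq_contra, Hy; lia.
  - rewrite sum_n_succ, residue_last.
    assert (Hb : a (S N) - y <> 0) by (apply Rminus_eq_contra, Hy; lia).
    set (b := a (S N)) in *.
    rewrite (sum_n_eq _ (fun n =>
      b / (b - y) * (a n * residue a n (S N) / (a n - y))
      + (- (b / (b - y))) * (a n * residue a n (S N) / (a n - b)))).
    + rewrite sum_n_lin, IH, IH.
      * change (Rprod (fun j => a j / (a j - y)) (S (S N)))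
          with (Rprod (fun j => a j / (a j - y)) (S N) * (b / (b - y))).
        field; exact Hb.
      * intros j Hj; apply Ha; lia.
      * intros j Hj; apply Hy; lia.
    + intros n Hn; rewrite residue_S by lia; fold b.
      assert (a n - y <> 0) by (apply Rminus_eq_contra, Hy; lia).
      assert (a n - b <> 0) by (apply Rminus_eq_contra, Ha; lia).
      field; repeat split; auto; lra.
Qed.

(** The expansion at [y = 0], where every factor of the product is 1. *)
Lemma sum_residue (a : nat -> R) (N : nat) :
  (forall i, a i <> 0) -> (forall i j, i <> j -> a i <> a j) ->
  sum_n (fun n => residue a n (S N)) N = 1 :> R.
Proof.
  intros H0 Ha.
  transitivity (Rprod (fun j => a j / (a j - 0)) (S N)).
  - rewrite <- partial_fractions by auto.
    apply sum_n_eq; intros n _; field; specialize (H0 n); lra.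
  - clear -H0; induction (S N) as [|p IH]; simpl; [easy|].
    rewrite IH; field; specialize (H0 p); lra.
Qed.

(** The coefficient of [y] in the expansion, found by induction instead of differentiation. With [b]
    the new node, [b/(a_n (b - a_n)) = 1/a_n + 1/b - a_n/(b (a_n - b))]. The three parts give the
    old sum, [1/b] by [sum_residue], and by [partial_fractions] at [b] a term that cancels the new
    summand. *)
Lemma sum_residue_div (a : nat -> R) (N : nat) :
  (forall i, a i <> 0) -> (forall i j, i <> j -> a i <> a j) ->
  sum_n (fun n => residue a n (S N) / a n) N = sum_n (fun n => / a n) N :> R.
Proof.
  intros H0 Ha; induction N as [|N IH].
  - rewrite !sum_O, residue_last; simpl; field; apply H0.
  - rewrite !sum_n_succ, residue_last; set (b := a (S N)).
    assert (Hb : b <> 0) by apply H0.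
    rewrite (sum_n_eq _ (fun n =>
      1 * (residue a n (S N) / a n)
      + 1 * (/ b * residue a n (S N)
             + (- / b) * (a n * residue a n (S N) / (a n - b))))).
    + rewrite sum_n_lin, IH, sum_n_lin, sum_residue, partial_fractions; auto.
      * field; exact Hb.
      * intros j Hj; apply Ha; lia.
    + intros n Hn; rewrite residue_S by lia; fold b.
      assert (a n - b <> 0) by (apply Rminus_eq_contra, Ha; lia).
      specialize (H0 n).
      field; repeat split; auto; lra.
Qed.

(** * Residues at the m-th powers *)

Definition powS (m j : nat) : R := INR (S j) ^ m.

Lemma powS_pos (m j : nat) : 0 < powS m j.
Proof. apply pow_lt, lt_0_INR; lia. Qed.

(* Horner form of [x^(m-1) + x^(m-2) y + ... + y^(m-1)]. *)
Fixpoint geom (m : nat) (x y : R) : R :=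
  match m with
  | O => 0
  | S p => x * geom p x y + y ^ p
  end.

Lemma geom_telescope (m : nat) (x y : R) :
  (x - y) * geom m x y = x ^ m - y ^ m.
Proof.
  induction m as [|m IH]; simpl; [ring|].
  replace ((x - y) * (x * geom m x y + y ^ m))
    with (x * ((x - y) * geom m x y) + (x - y) * y ^ m) by ring.
  rewrite IH; ring.
Qed.

(** The extra factor [x] avoids the exponent [m - 1]. *)
Lemma geom_diag (m : nat) (x : R) : x * geom m x x = INR m * x ^ m.
Proof.
  induction m as [|m IH]; [simpl; ring|].
  rewrite S_INR; simpl; rewrite IH; ring.
Qed.

Lemma geom_pos (m : nat) (x y : R) :
  0 < x -> 0 < y -> 0 < geom (S m) x y.
Proof.
  intros Hx Hy; induction m as [|m IH]; [simpl; lra|].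
  change (0 < x * geom (S m) x y + y ^ S m).
  assert (0 < y ^ S m) by now apply pow_lt.
  assert (0 < x * geom (S m) x y) by now apply Rmult_lt_0_compat.
  lra.
Qed.

Lemma powS_inj (m i j : nat) :
  (1 <= m)%nat -> i <> j -> powS m i <> powS m j.
Proof.
  intros Hm Hij H; apply Hij.
  destruct m as [|m]; [lia|].
  assert (0 < geom (S m) (INR (S i)) (INR (S j)))
    by (apply geom_pos; apply lt_0_INR; lia).
  apply eq_add_S, INR_eq.
  pose proof (geom_telescope (S m) (INR (S i)) (INR (S j))) as E.
  unfold powS in H; nra.
Qed.

(** Below the puncture each denominator is [-(n - j)]. The signs collect to [(-1)^N] and the
    absolute values to [n!/(n - N)!]. *)
Lemma residue_lin_before (n N : nat) :
  (N <= n)%nat ->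
  Rprod (fun j => INR (S j) / (INR (S j) - INR (S n))) N
  = (-1) ^ N * INR (fact N) * INR (fact (n - N)) / INR (fact n).
Proof.
  induction N as [|N IH]; intros H.
  - rewrite Nat.sub_0_r; simpl; field; apply INR_fact_neq_0.
  - cbn [Rprod]; rewrite IH by lia.
    replace (n - N)%nat with (S (n - S N)) by lia.
    rewrite !fact_simpl, !mult_INR.
    replace (INR (S (n - S N))) with (INR (S n) - INR (S N))
      by (rewrite <- minus_INR by lia; f_equal; lia).
    assert (INR (S N) < INR (S n)) by (apply lt_INR; lia).
    simpl pow; field; split; [apply INR_fact_neq_0|lra].
Qed.

(* [(-1)^n C(N, S n)], with [N = S n + d]. *)
Lemma residue_lin (n d : nat) :
  Rprod (puncture (fun j => INR (S j) / (INR (S j) - INR (S n))) n) (S n + d)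
  = (-1) ^ n * INR (fact (S n + d)) / (INR (fact (S n)) * INR (fact d)).
Proof.
  induction d as [|d IH].
  - rewrite Nat.add_0_r; cbn [Rprod].
    rewrite puncture_at, Rprod_puncture_out, residue_lin_before by lia.
    rewrite Nat.sub_diag; simpl (fact 0); simpl (INR 1).
    field; split; apply INR_fact_neq_0.
  - rewrite Nat.add_succ_r; cbn [Rprod]; rewrite IH, puncture_neq by lia.
    rewrite (fact_simpl (S n + d)), (fact_simpl d), !mult_INR.
    replace (INR (S (S n + d)) - INR (S n)) with (INR (S d))
      by (rewrite <- minus_INR by lia; f_equal; lia).
    assert (0 < INR (S d)) by (apply lt_0_INR; lia).
    field; repeat split; try apply INR_fact_neq_0; lra.
Qed.

(** Each factor splits as [x/(x - y)] times [x^m / geom (S m) x y]. The linear parts give a signed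
    binomial coefficient. The other parts are regular at [j = n], so their product may run over all
    [j]; the factor so added is [1/(m + 1)] by [geom_diag], whence the leading [INR (S m)]. *)
Lemma residue_powS (m n d : nat) :
  residue (powS (S m)) n (S n + d)
  = INR (S m) * (-1) ^ n
    * INR (fact (S n + d)) / (INR (fact (S n)) * INR (fact d))
    * INR (fact (S n + d)) ^ m
    / Rprod (fun j => geom (S m) (INR (S j)) (INR (S n))) (S n + d).
Proof.
  set (N := (S n + d)%nat).
  set (g := fun j => INR (S j) ^ m / geom (S m) (INR (S j)) (INR (S n))).
  assert (Hpos : forall j, 0 < INR (S j)) by (intros; apply lt_0_INR; lia).
  assert (Hg : forall j, 0 < geom (S m) (INR (S j)) (INR (S n)))
    by (intros; now apply geom_pos).
  transitivity (Rprod (puncture (fun j => INR (S j) / (INR (S j) - INR (S n))) n) N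
                * Rprod (puncture g n) N).
  { rewrite <- Rprod_mult; apply Rprod_ext; intros j _.
    unfold puncture; destruct (Nat.eqb_spec j n) as [_|Hj]; [ring|].
    unfold powS, g; rewrite <- geom_telescope.
    assert (INR (S j) - INR (S n) <> 0)
      by (apply Rminus_eq_contra; intros E; apply INR_eq in E; lia).
    specialize (Hg j); rewrite <- tech_pow_Rmult; field; split; lra. }
  unfold N at 1; rewrite residue_lin; fold N.
  assert (Eg : g n * INR (S m) = 1).
  { unfold g; pose proof (geom_diag (S m) (INR (S n))) as E.
    specialize (Hg n); specialize (Hpos n).
    rewrite <- tech_pow_Rmult in E.
    assert (E' : geom (S m) (INR (S n)) (INR (S n)) = INR (S m) * INR (S n) ^ m)
      by (apply Rmult_eq_reg_l with (INR (S n)); lra).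
    assert (0 < INR (S n) ^ m) by now apply pow_lt.
    assert (0 < INR (S m)) by (apply lt_0_INR; lia).
    rewrite E'; field; split; lra. }
  assert (E : Rprod g N * INR (S m) = Rprod (puncture g n) N).
  { rewrite (Rprod_puncture g n N) by (unfold N; lia).
    replace (g n * Rprod (puncture g n) N * INR (S m))
      with (g n * INR (S m) * Rprod (puncture g n) N) by ring.
    rewrite Eg; ring. }
  rewrite <- E; unfold g, Rdiv.
  rewrite Rprod_mult, Rprod_inv, Rprod_pow, Rprod_INR_S; ring.
Qed.

Lemma residue_2_bound (n d : nat) :
  Rabs (residue (powS 2) n (S n + d)) <= 2.
Proof.
  rewrite residue_powS; set (N := (S n + d)%nat).
  (* Here [geom 2 x y = x + y], so the product is a quotient of factorials. *)
  assert (E : Rprod (fun j => geom 2 (INR (S j)) (INR (S n))) N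
              = INR (fact (N + S n)) / INR (fact (S n))).
  { clear; induction N as [|N IH]; [simpl; field; apply (INR_fact_neq_0 (S n))|].
    cbn [Rprod]; rewrite IH.
    change (fact (S N + S n)) with (S (N + S n) * fact (N + S n))%nat.
    rewrite mult_INR, (S_INR (N + S n)), plus_INR, (S_INR N).
    cbn [geom]; field; apply (INR_fact_neq_0 (S n)). }
  rewrite E.
  assert (F : forall k, 0 < INR (fact k)) by apply INR_fact_lt_0.
  (* This is [N!^2 <= (N + k)! (N - k)!], by induction on [k] with [d = N - k] fixed: one step
     multiplies the left by [(k + d + 1)^2] and the right by [(2k + d + 1)(2k + d + 2)]. *)
  assert (Hle : INR (fact N) * INR (fact N) <= INR (fact (N + S n)) * INR (fact d)).
  { unfold N; generalize (S n) as k; clear; intros k.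
    rewrite <- !mult_INR; apply le_INR.
    induction k as [|k IH]; [now rewrite Nat.add_0_r|].
    replace (S k + d + S k)%nat with (S (S (k + d + k))) by lia.
    simpl (S k + d)%nat; rewrite !fact_simpl.
    assert (Hf : (fact (k + d) * fact (k + d) <= fact (k + d + k) * fact d)%nat)
      by exact IH.
    apply Nat.le_trans
      with (S (k + d) * S (k + d) * (fact (k + d + k) * fact d))%nat.
    - replace (S (k + d) * fact (k + d) * (S (k + d) * fact (k + d)))%nat
        with (S (k + d) * S (k + d) * (fact (k + d) * fact (k + d)))%nat by ring.
      now apply Nat.mul_le_mono_l.
    - replace (S (S (k + d + k)) * (S (k + d + k) * fact (k + d + k)) * fact d)%nat
        with (S (S (k + d + k)) * S (k + d + k) * (fact (k + d + k) * fact d))%nat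
        by ring.
      apply Nat.mul_le_mono_r; nia. }
  set (X := INR (fact N) * INR (fact N) / (INR (fact (N + S n)) * INR (fact d))).
  assert (HX : 0 <= X <= 1).
  { unfold X; split.
    - apply Rlt_le, Rdiv_lt_0_compat; apply Rmult_lt_0_compat; apply F.
    - apply Rle_div_l; [apply Rmult_lt_0_compat; apply F|lra]. }
  replace (INR 2 * (-1) ^ n * INR (fact N) / (INR (fact (S n)) * INR (fact d))
           * INR (fact N) ^ 1 / (INR (fact (N + S n)) / INR (fact (S n))))
    with ((-1) ^ n * (2 * X)).
  - rewrite Rabs_mult, pow_1_abs, Rabs_pos_eq; lra.
  - unfold X; change (INR 2) with (1 + 1).
    field; repeat split; apply INR_fact_neq_0.
Qed.

(** After division by [x - y] and with [m = p + 2], it remains to see that [geom m x y], a sum of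
    positive terms, is at least its two leading ones, [x^p (x + y)]. *)
Lemma ratio_pow_le (m : nat) (x y : R) :
  (2 <= m)%nat -> 0 < x -> 0 < y -> x <> y ->
  Rabs (x ^ m / (x ^ m - y ^ m)) <= Rabs (x ^ 2 / (x ^ 2 - y ^ 2)).
Proof.
  intros Hm Hx Hy Hxy.
  destruct m as [|[|p]]; [lia|lia|].
  assert (G : geom 2 x y * x ^ p <= geom (S (S p)) x y).
  { clear Hm; induction p as [|p IH]; [simpl; lra|].
    change (geom (S (S (S p))) x y) with (x * geom (S (S p)) x y + y ^ S (S p)).
    assert (0 < y ^ S (S p)) by now apply pow_lt.
    simpl pow at 1; nra. }
  assert (P2 : 0 < geom 2 x y) by now apply geom_pos.
  assert (Pp : 0 < geom (S (S p)) x y) by now apply geom_pos.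
  assert (Xp : 0 < x ^ p) by now apply pow_lt.
  rewrite <- !geom_telescope.
  set (A := geom 2 x y) in *; set (B := geom (S (S p)) x y) in *.
  replace (x ^ 2 / ((x - y) * A)) with (x ^ 2 / (x - y) * / A)
    by (field; split; lra).
  replace (x ^ S (S p) / ((x - y) * B)) with (x ^ 2 / (x - y) * (x ^ p / B))
    by (simpl; field; split; lra).
  rewrite (Rabs_mult _ (_ / B)), (Rabs_mult _ (/ A)).
  apply Rmult_le_compat_l; [apply Rabs_pos|].
  rewrite !Rabs_pos_eq.
  - apply Rle_div_l; [easy|].
    apply Rmult_le_reg_r with A; [easy|].
    replace (/ A * B * A) with B by (field; lra); lra.
  - now apply Rlt_le, Rinv_0_lt_compat.
  - now apply Rlt_le, Rdiv_lt_0_compat.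
Qed.

Lemma residue_bound (m n N : nat) :
  (2 <= m)%nat -> (n < N)%nat -> Rabs (residue (powS m) n N) <= 2.
Proof.
  intros Hm HN.
  apply Rle_trans with (Rabs (residue (powS 2) n N)).
  - apply Rprod_abs_le; intros j _; unfold puncture.
    destruct (Nat.eqb_spec j n) as [_|Hj]; [lra|].
    apply ratio_pow_le; auto; try (apply lt_0_INR; lia).
    intros E; apply INR_eq in E; lia.
  - replace N with (S n + (N - S n))%nat by lia; apply residue_2_bound.
Qed.

(** * Interchanging limit and sum *)

(** Tannery's theorem, with the limit of the full sums given. Sums up to a fixed [K] pass to the
    limit, and the rest is at most the tail of [M] beyond [K], uniformly in [N]. Hence [sum_n g K]
    is within that tail of [l]. *)
Lemma tannery (f : nat -> nat -> R) (g M : nat -> R) (l : R) :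
  (forall N n, (n <= N)%nat -> Rabs (f N n) <= M n) ->
  ex_series M ->
  (forall n, is_lim_seq (fun N => f N n) (g n)) ->
  is_lim_seq (fun N => sum_n (f N) N) l ->
  is_series g l.
Proof.
  intros Hf [s Hs] Hg Hl.
  assert (HM : forall n, 0 <= M n).
  { intros n; apply Rle_trans with (1 := Rabs_pos (f n n)); auto. }
  assert (Hsum : forall K, is_lim_seq (fun N => sum_n (f N) K) (sum_n g K)).
  { induction K as [|K IH].
    - apply is_lim_seq_ext with (fun N => f N 0%nat).
      + intros N; now rewrite sum_O.
      + now rewrite sum_O.
    - apply is_lim_seq_ext with (fun N => sum_n (f N) K + f N (S K)).
      + intros N; now rewrite sum_n_succ.
      + rewrite sum_n_succ; now apply is_lim_seq_plus'. }
  assert (Hs' : is_lim_seq (sum_n M) s) by exact Hs.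
  assert (Hms : forall K, sum_n M K <= s).
  { intros K.
    apply (is_lim_seq_incr_compare _ _ Hs').
    intros n; rewrite sum_n_succ; specialize (HM (S n)); lra. }
  assert (Htail : forall K d,
    Rabs (sum_n (f (K + d)%nat) (K + d) - sum_n (f (K + d)%nat) K) <= s - sum_n M K).
  { intros K d.
    apply Rle_trans with (sum_n M (K + d) - sum_n M K);
      [|specialize (Hms (K + d)%nat); lra].
    enough (H : forall N e, (K + e <= N)%nat ->
      Rabs (sum_n (f N) (K + e) - sum_n (f N) K) <= sum_n M (K + e) - sum_n M K)
      by (apply H; lia).
    intros N e; induction e as [|e IH]; intros He.
    - rewrite Nat.add_0_r, !Rminus_diag, Rabs_R0; lra.
    - rewrite Nat.add_succ_r, !sum_n_succ.
      specialize (IH ltac:(lia)).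
      pose proof (Hf N (S (K + e)) ltac:(lia)).
      replace (sum_n (f N) (K + e) + f N (S (K + e)) - sum_n (f N) K)
        with (sum_n (f N) (K + e) - sum_n (f N) K + f N (S (K + e))) by ring.
      apply Rle_trans with (1 := Rabs_triang _ _); lra. }
  assert (Hdist : forall K, Rabs (l - sum_n g K) <= s - sum_n M K).
  { intros K.
    assert (H : is_lim_seq
      (fun N => Rabs (sum_n (f N) N - sum_n (f N) K)) (Rabs (l - sum_n g K))).
    { apply (is_lim_seq_abs _ (Finite (l - sum_n g K))).
      apply is_lim_seq_minus'; auto. }
    (* The tail estimate needs [N >= K], so the sequence is read from [N = K + d]. *)
    apply (is_lim_seq_incr_n _ K) in H.
    refine (is_lim_seq_le _ _ (Finite _) (Finite _) _ H
              (is_lim_seq_const (s - sum_n M K))).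
    intros d; simpl; rewrite Nat.add_comm; apply Htail. }
  change (is_lim_seq (sum_n g) l).
  assert (T : is_lim_seq (fun K => s - sum_n M K) 0).
  { replace (Finite 0) with (Finite (s - s)) by (f_equal; ring).
    apply is_lim_seq_minus'; [apply is_lim_seq_const|exact Hs']. }
  apply is_lim_seq_le_le with (fun K => l - (s - sum_n M K))
                              (fun K => l + (s - sum_n M K)).
  - intros K; specialize (Hdist K); apply Rabs_le_between in Hdist; lra.
  - replace (Finite l) with (Finite (l - 0)) by (f_equal; ring).
    apply is_lim_seq_minus'; [apply is_lim_seq_const|exact T].
  - replace (Finite l) with (Finite (l + 0)) by (f_equal; ring).
    apply is_lim_seq_plus'; [apply is_lim_seq_const|exact T].
Qed.

Lemma ex_series_inv_pow (m : nat) :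
  (2 <= m)%nat -> ex_series (fun j => / powS m j).
Proof.
  intros Hm.
  assert (H2 : ex_series (fun j => / powS 2 j)).
  { assert (H : ex_finite_lim_seq (sum_n (fun j => / powS 2 j))).
    { apply ex_finite_lim_seq_incr with 2.
      - intros n; rewrite sum_n_succ.
        assert (0 < / powS 2 (S n)) by apply Rinv_0_lt_compat, powS_pos; lra.
      (* The sharper bound [2 - 1/(n + 1)] is inductive, because
         [1/(x + 1)^2 <= 1/x - 1/(x + 1)]. *)
      - intros n; apply Rle_trans with (2 - / INR (S n)).
        + induction n as [|n IH].
          * rewrite sum_O; unfold powS; simpl; lra.
          * rewrite sum_n_succ.
            assert (Hn : 0 < INR (S n)) by (apply lt_0_INR; lia).
            assert (/ powS 2 (S n) <= / INR (S n) - / INR (S (S n))).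
            { unfold powS; rewrite (S_INR (S n)); set (x := INR (S n)) in *.
              replace (/ x - / (x + 1)) with (/ (x * (x + 1))) by (field; lra).
              apply Rinv_le_contravar; [nra|simpl; nra]. }
            change (sum_n (fun j => / powS 2 j) n + / powS 2 (S n)
                    <= 2 - / INR (S (S n))); lra.
        + assert (0 < / INR (S n)) by (apply Rinv_0_lt_compat, lt_0_INR; lia); lra. }
    destruct H as [l Hl]; now exists l. }
  apply (ex_series_le (K := R_AbsRing) (V := R_CompleteNormedModule) _
           (fun j => / powS 2 j)); [|exact H2].
  intros j; unfold norm; simpl; unfold abs; simpl.
  rewrite Rabs_pos_eq by (apply Rlt_le, Rinv_0_lt_compat, powS_pos).
  apply Rinv_le_contravar; [apply powS_pos|].
  apply Rle_pow; [|easy].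
  rewrite S_INR; pose proof (pos_INR j); lra.
Qed.

Lemma series_residue (m : nat) (W : nat -> R) :
  (2 <= m)%nat ->
  (forall n, is_lim_seq (fun N => residue (powS m) n (S N)) (W n)) ->
  is_series (fun n => W n / powS m n) (Series (fun j => / powS m j)).
Proof.
  intros Hm HW.
  apply (tannery (fun N n => residue (powS m) n (S N) / powS m n) _
           (fun n => 2 * / powS m n)).
  - intros N n Hn; unfold Rdiv; rewrite Rabs_mult.
    assert (0 < / powS m n) by apply Rinv_0_lt_compat, powS_pos.
    rewrite (Rabs_pos_eq (/ _)) by lra.
    apply Rmult_le_compat_r; [lra|]; apply residue_bound; lia.
  - apply (ex_series_scal_l (K := R_AbsRing) (V := R_NormedModule) 2
             (fun n => / powS m n)), ex_series_inv_pow, Hm.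
  - intros n; apply (is_lim_seq_mult' _ _ (W n) (/ powS m n)); auto.
    apply is_lim_seq_const.
  - apply is_lim_seq_ext with (sum_n (fun j => / powS m j)).
    + intros N; symmetry; apply sum_residue_div.
      * intros i; apply Rgt_not_eq, powS_pos.
      * intros i j; apply powS_inj; lia.
    + apply (Series_correct (fun j => / powS m j)), ex_series_inv_pow, Hm.
Qed.

(** * Convergence of Gauss's product *)

(** Componentwise, to match [CLim_seq], and with finite limits, so that the default value of [real]
    never intervenes. *)
Definition is_Clim (u : nat -> C) (l : C) : Prop :=
  is_lim_seq (fun n => Re (u n)) (Re l) /\ is_lim_seq (fun n => Im (u n)) (Im l).

Lemma is_Clim_unique (u : nat -> C) (l : C) : is_Clim u l -> CLim_seq u = l.
Proof.
  intros [H1 H2]; unfold CLim_seq.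
  rewrite (is_lim_seq_unique _ _ H1), (is_lim_seq_unique _ _ H2).
  now destruct l.
Qed.

Lemma is_Clim_const (c : C) : is_Clim (fun _ => c) c.
Proof. split; apply is_lim_seq_const. Qed.

Lemma is_Clim_RtoC (u : nat -> R) (l : R) :
  is_lim_seq u l -> is_Clim (fun n => RtoC (u n)) l.
Proof. intros H; split; [exact H|apply is_lim_seq_const]. Qed.

(** Used to see that the gamma products are real: they arise as limits of real residues. *)
Lemma is_Clim_real (u : nat -> R) (l : C) :
  is_Clim (fun n => RtoC (u n)) l -> l = RtoC (Re l).
Proof.
  destruct l as [a b]; intros [_ H].
  apply is_lim_seq_unique in H; simpl in H; rewrite Lim_seq_const in H.
  now injection H as <-.
Qed.

Lemma is_Clim_mult (u v : nat -> C) (l k : C) :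
  is_Clim u l -> is_Clim v k -> is_Clim (fun n => u n * v n)%C (l * k)%C.
Proof.
  intros [H1 H2] [H3 H4]; split; simpl.
  - apply is_lim_seq_minus'; apply is_lim_seq_mult'; auto.
  - apply is_lim_seq_plus'; apply is_lim_seq_mult'; auto.
Qed.

Lemma is_Clim_ext_loc (u v : nat -> C) (l : C) :
  eventually (fun n => u n = v n) -> is_Clim u l -> is_Clim v l.
Proof.
  intros [N HN] [H1 H2]; split.
  - refine (is_lim_seq_ext_loc _ _ _ _ H1); exists N; intros; now rewrite HN.
  - refine (is_lim_seq_ext_loc _ _ _ _ H2); exists N; intros; now rewrite HN.
Qed.

Lemma is_Clim_Cprod (u : nat -> nat -> C) (l : nat -> C) (p : nat) :
  (forall k, (k < p)%nat -> is_Clim (u k) (l k)) ->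
  is_Clim (fun n => Cprod (fun k => u k n) p) (Cprod l p).
Proof.
  induction p as [|p IH]; intros H; simpl.
  - apply is_Clim_const.
  - apply is_Clim_mult; auto.
Qed.

Lemma im_le_Cmod (c : C) : Rabs (Im c) <= Cmod c.
Proof. apply Rle_trans with (2 := Rmax_Cmod c), Rmax_r. Qed.

Lemma Cmod_le_sum (c : C) : Cmod c <= Rabs (Re c) + Rabs (Im c).
Proof.
  replace c with (RtoC (Re c) + Ci * RtoC (Im c))%C at 1
    by (destruct c; unfold Ci, Cmult, Cplus, RtoC; simpl; f_equal; ring).
  apply Rle_trans with (1 := Cmod_triangle _ _).
  rewrite Cmod_mult, Cmod_Ci, !Cmod_R; lra.
Qed.

Lemma bounded_variation_cv (v c : nat -> R) :
  (forall n, Rabs (v (S n) - v n) <= c n) -> ex_series c ->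
  exists l : R, is_lim_seq v l.
Proof.
  intros Hv Hc.
  destruct (ex_series_le (K := R_AbsRing) (V := R_CompleteNormedModule)
              (fun n => v (S n) - v n) c Hv Hc) as [s Hs].
  exists (v 0%nat + s).
  apply is_lim_seq_incr_1.
  apply is_lim_seq_ext with (fun N => v 0%nat + sum_n (fun n => v (S n) - v n) N).
  - induction n as [|n IH].
    + rewrite sum_O; ring.
    + rewrite sum_n_succ, <- Rplus_assoc, IH; ring.
  - apply is_lim_seq_plus'; [apply is_lim_seq_const|exact Hs].
Qed.

(** No logarithm is taken. From [1 + b <= exp b] the sequence is bounded by [B = |u 0| exp s], with
    [s] the sum of [b]. Its increments [u n * e n] are then at most [B * b n], which is summable. *)
Lemma infinite_product_cv (u e : nat -> C) (b : nat -> R) :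
  (forall n, u (S n) = (u n * (1 + e n))%C) ->
  (forall n, Cmod (e n) <= b n) -> ex_series b ->
  exists l, is_Clim u l.
Proof.
  intros Hu He Hb.
  assert (Hb0 : forall n, 0 <= b n)
    by (intros n; apply Rle_trans with (2 := He n), Cmod_ge_0).
  destruct Hb as [s Hs].
  assert (Hs' : is_lim_seq (sum_n b) s) by exact Hs.
  assert (Hle : forall K, sum_n b K <= s).
  { intros K; apply (is_lim_seq_incr_compare _ _ Hs').
    intros n; rewrite sum_n_succ; specialize (Hb0 (S n)); lra. }
  assert (Hstep : forall n x, Cmod (u n) <= Cmod (u 0%nat) * exp x ->
            Cmod (u (S n)) <= Cmod (u 0%nat) * exp (x + b n)).
  { intros n x H; rewrite Hu, Cmod_mult, exp_plus, <- Rmult_assoc.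
    apply Rmult_le_compat; try apply Cmod_ge_0; [exact H|].
    apply Rle_trans with (1 := Cmod_triangle _ _); rewrite Cmod_1.
    specialize (He n); pose proof (exp_ineq1_le (b n)); lra. }
  assert (Hpart : forall n, Cmod (u (S n)) <= Cmod (u 0%nat) * exp (sum_n b n)).
  { induction n as [|n IH].
    - rewrite sum_O, <- (Rplus_0_l (b 0%nat)).
      apply Hstep; rewrite exp_0; lra.
    - rewrite sum_n_succ; apply Hstep, IH. }
  set (B := Cmod (u 0%nat) * exp s).
  assert (Hmono : forall x, x <= s -> Cmod (u 0%nat) * exp x <= B).
  { intros x Hx; apply Rmult_le_compat_l; [apply Cmod_ge_0|].
    destruct Hx as [Hx| ->]; [now apply Rlt_le, exp_increasing|lra]. }
  assert (HB : forall n, Cmod (u n) <= B).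
  { intros [|n].
    - apply Rle_trans with (Cmod (u 0%nat) * exp 0); [rewrite exp_0; lra|].
      apply Hmono, Rle_trans with (sum_n b 0%nat); [|apply Hle].
      rewrite sum_O; apply Hb0.
    - apply Rle_trans with (1 := Hpart n), Hmono, Hle. }
  assert (Hd : forall n, Cmod (u (S n) - u n) <= B * b n).
  { intros n; replace (u (S n) - u n)%C with (u n * e n)%C by (rewrite Hu; ring).
    rewrite Cmod_mult; apply Rmult_le_compat; auto using Cmod_ge_0. }
  assert (Hc : ex_series (fun n => B * b n)).
  { apply (ex_series_scal_l (K := R_AbsRing) (V := R_NormedModule) B b).
    now exists s. }
  destruct (bounded_variation_cv (fun n => Re (u n)) (fun n => B * b n)) as [l1 H1].
  - intros n; apply Rle_trans with (2 := Hd n), (re_le_Cmod (u (S n) - u n)%C).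
  - exact Hc.
  - destruct (bounded_variation_cv (fun n => Im (u n)) (fun n => B * b n)) as [l2 H2].
    + intros n; apply Rle_trans with (2 := Hd n), (im_le_Cmod (u (S n) - u n)%C).
    + exact Hc.
    + exists (l1, l2); now split.
Qed.

(** * The complex exponential near 0 *)

Lemma Cexp_plus (z w : C) : Cexp (z + w) = (Cexp z * Cexp w)%C.
Proof.
  destruct z as [a b], w as [c d]; unfold Cexp, Cmult, Cplus, RtoC; simpl.
  rewrite exp_plus, cos_plus, sin_plus; f_equal; ring.
Qed.

Lemma Cexp_0 : Cexp 0 = 1%C.
Proof.
  unfold Cexp, Cmult, RtoC; simpl.
  rewrite exp_0, cos_0, sin_0; f_equal; ring.
Qed.

Lemma Cexp_pow (z : C) (k : nat) : (Cexp z ^ k)%C = Cexp (INR k * z).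
Proof.
  induction k as [|k IH].
  - simpl; rewrite Cmult_0_l; now rewrite Cexp_0.
  - rewrite Cpow_S, IH, <- Cexp_plus, S_INR, RtoC_plus; f_equal; ring.
Qed.

Lemma sin_abs_le (x : R) : Rabs (sin x) <= Rabs x.
Proof.
  destruct (MVT_gen sin 0 x cos) as [c [_ Hc]].
  - intros; auto_derive; [easy|ring].
  - intros; apply continuity_sin.
  - rewrite sin_0, !Rminus_0_r in Hc; rewrite Hc, Rabs_mult.
    pose proof (Rabs_pos x).
    assert (Rabs (cos c) <= 1) by (apply Rabs_le, COS_bound); nra.
Qed.

Lemma one_minus_cos_le (x : R) : 0 <= 1 - cos x <= x ^ 2 / 2.
Proof.
  assert (E : 1 - cos x = 2 * sin (x / 2) ^ 2).
  { replace x with (2 * (x / 2)) at 1 by field.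
    rewrite cos_2a_sin; simpl; ring. }
  assert (sin (x / 2) ^ 2 <= (x / 2) ^ 2)
    by (rewrite <- (pow2_abs (sin _)), <- (pow2_abs (x / 2));
        apply pow_incr; split; [apply Rabs_pos|apply sin_abs_le]).
  assert (0 <= sin (x / 2) ^ 2) by apply pow2_ge_0.
  lra.
Qed.

Lemma sin_minus_id_le (x : R) : Rabs (sin x - x) <= Rabs x * (x ^ 2 / 2).
Proof.
  destruct (MVT_gen (fun t => sin t - t) 0 x (fun t => cos t - 1)) as [c [Hc E]].
  - intros; auto_derive; [easy|ring].
  - intros; apply continuity_pt_minus; [apply continuity_sin|].
    apply derivable_continuous_pt, derivable_pt_id.
  - rewrite sin_0, !Rminus_0_r in E; rewrite E, Rabs_mult, Rmult_comm.
    apply Rmult_le_compat_l; [apply Rabs_pos|].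
    rewrite Rabs_minus_sym, Rabs_pos_eq by apply one_minus_cos_le.
    apply Rle_trans with (c ^ 2 / 2); [apply one_minus_cos_le|].
    assert (c ^ 2 <= x ^ 2); [|lra].
    rewrite <- (pow2_abs c), <- (pow2_abs x); apply pow_incr.
    split; [apply Rabs_pos|].
    revert Hc; unfold Rmin, Rmax, Rabs.
    destruct (Rle_dec 0 x), (Rcase_abs c), (Rcase_abs x); lra.
Qed.

(** From [exp (-a) >= 1 - a] one gets [(1 - a) exp a <= 1], hence [(1 - a)(exp a - 1 - a) <= a^2],
    and [1 - a >= 1/2]. *)
Lemma exp_taylor1 (a : R) : Rabs a <= / 2 -> Rabs (exp a - 1 - a) <= 2 * a ^ 2.
Proof.
  intros H; apply Rabs_le_between in H.
  pose proof (exp_ineq1_le a) as H1.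
  pose proof (exp_ineq1_le (- a)) as H2; rewrite exp_Ropp in H2.
  pose proof (exp_pos a) as H3.
  assert (H4 : (1 - a) * exp a <= 1).
  { apply Rmult_le_reg_r with (/ exp a); [now apply Rinv_0_lt_compat|].
    replace ((1 - a) * exp a * / exp a) with (1 - a) by (field; lra); lra. }
  rewrite Rabs_pos_eq by lra.
  assert ((1 - a) * (exp a - 1 - a) <= a ^ 2) by (simpl; nra).
  nra.
Qed.

(** For [w = a + ib] the real part of the error is at most [2a^2 + b^2] and the imaginary part at
    most [b^2/2 + 2|a||b| <= a^2 + 3b^2/2]; the constant 3 covers their sum. *)
Lemma Cexp_taylor1 (w : C) :
  Cmod w <= / 2 -> Cmod (Cexp w - 1 - w) <= 3 * Cmod w ^ 2.
Proof.
  intros Hw; rewrite Cmod2_alt.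
  pose proof (Rle_trans _ _ _ (re_le_Cmod w) Hw) as Ha.
  pose proof (Rle_trans _ _ _ (im_le_Cmod w) Hw) as Hb.
  destruct w as [a b]; simpl Re in *; simpl Im in *; clear Hw.
  apply Rle_trans with (1 := Cmod_le_sum _).
  pose proof (exp_taylor1 a Ha) as E1.
  pose proof (one_minus_cos_le b) as E2.
  pose proof (sin_minus_id_le b) as E3.
  pose proof (exp_pos a) as E0.
  assert (E4 : exp a <= 2).
  { apply Rabs_le_between in Ha; apply Rabs_le_between in E1; nra. }
  assert (E5 : Rabs (exp a - 1) <= 2 * Rabs a).
  { replace (exp a - 1) with ((exp a - 1 - a) + a) by ring.
    apply Rle_trans with (1 := Rabs_triang _ _).
    rewrite <- (pow2_abs a) in E1; pose proof (Rabs_pos a); nra. }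
  unfold Cexp; simpl.
  replace (exp a * cos b - 0 * sin b + - (1) + - a)
    with ((exp a - 1 - a) + - (exp a * (1 - cos b))) by ring.
  replace (exp a * sin b + 0 * cos b + - 0 + - b)
    with (exp a * (sin b - b) + (exp a - 1) * b) by ring.
  assert (F1 : Rabs ((exp a - 1 - a) + - (exp a * (1 - cos b))) <= 2 * a ^ 2 + b ^ 2).
  { apply Rle_trans with (1 := Rabs_triang _ _).
    rewrite Rabs_Ropp, (Rabs_pos_eq (exp a * _)) by (apply Rmult_le_pos; lra).
    assert (exp a * (1 - cos b) <= 2 * (b ^ 2 / 2)) by (apply Rmult_le_compat; lra).
    lra. }
  assert (F2 : Rabs (exp a * (sin b - b) + (exp a - 1) * b)
               <= b ^ 2 / 2 + 2 * (Rabs a * Rabs b)).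
  { apply Rle_trans with (1 := Rabs_triang _ _).
    rewrite !Rabs_mult, (Rabs_pos_eq (exp a)) by lra.
    assert (exp a * Rabs (sin b - b) <= 2 * (/ 2 * (b ^ 2 / 2))).
    { apply Rmult_le_compat; try lra; [apply Rabs_pos|].
      apply Rle_trans with (1 := E3), Rmult_le_compat_r; [|exact Hb].
      pose proof (pow2_ge_0 b); lra. }
    assert (Rabs (exp a - 1) * Rabs b <= 2 * Rabs a * Rabs b)
      by (apply Rmult_le_compat_r; [apply Rabs_pos|exact E5]).
    lra. }
  assert (F3 : 2 * (Rabs a * Rabs b) <= a ^ 2 + b ^ 2).
  { rewrite <- (pow2_abs a), <- (pow2_abs b).
    pose proof (pow2_ge_0 (Rabs a - Rabs b)); nra. }
  pose proof (pow2_ge_0 a); pose proof (pow2_ge_0 b); simpl in *; lra.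
Qed.

(** * Gauss's sequence and its limit *)

Definition gauss (z : C) (n : nat) : C :=
  (INR (fact n) * Rpow_C (INR n) z / Cprod (fun j => z + INR j) (S n))%C.

Lemma ln_le_minus_1 (x : R) : 0 < x -> ln x <= x - 1.
Proof.
  intros Hx; pose proof (exp_ineq1_le (ln x)) as H.
  rewrite exp_ln in H by easy; lra.
Qed.

Lemma ln_ratio_bounds (x : R) :
  0 < x -> / (x + 1) <= ln ((x + 1) / x) <= / x.
Proof.
  intros Hx; split.
  - assert (H : ln (x / (x + 1)) <= x / (x + 1) - 1)
      by (apply ln_le_minus_1, Rdiv_lt_0_compat; lra).
    replace (x / (x + 1)) with (/ ((x + 1) / x)) in H at 1 by (field; lra).
    rewrite ln_Rinv in H by (apply Rdiv_lt_0_compat; lra).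
    replace (x / (x + 1) - 1) with (- / (x + 1)) in H by (field; lra); lra.
  - replace (/ x) with ((x + 1) / x - 1) by (field; lra).
    apply ln_le_minus_1, Rdiv_lt_0_compat; lra.
Qed.

Lemma Rpow_C_ratio (z : C) (x : R) :
  0 < x -> Rpow_C (x + 1) z = (Rpow_C x z * Cexp (z * ln ((x + 1) / x)))%C.
Proof.
  intros Hx; unfold Rpow_C; rewrite <- Cexp_plus; f_equal.
  rewrite ln_div by lra; rewrite RtoC_minus; ring.
Qed.

Lemma Cmod_shift_ge (z : C) (x : R) :
  2 * Cmod z <= x -> 1 <= x -> (x + 1) / 2 <= Cmod (z + RtoC (x + 1)).
Proof.
  intros Hz Hx.
  pose proof (Cmod_triangle (z + RtoC (x + 1)) (- z)) as H.
  replace (z + RtoC (x + 1) + - z)%C with (RtoC (x + 1)) in H by ring.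
  rewrite Cmod_opp, Cmod_R, Rabs_pos_eq in H by lra; lra.
Qed.

(** For [x = n] the quotient is [gauss z (n+1) / gauss z n]. With [t = ln((x+1)/x)], its distance
    from 1 is a factor of modulus at most 2 times [(Cexp(zt) - 1 - zt) + z (t - 1/(x+1))]. Both
    summands are of order [1/x^2], the second because [t] lies between [1/(x+1)] and [1/x]. *)
Lemma gauss_factor_bound (z : C) (x : R) :
  2 * Cmod z <= x -> 1 <= x ->
  Cmod (Cexp (z * ln ((x + 1) / x)) * RtoC (x + 1) / (z + RtoC (x + 1)) - 1)
  <= 2 * (3 * Cmod z ^ 2 + Cmod z) * / x ^ 2.
Proof.
  intros Hz Hx.
  set (t := ln ((x + 1) / x)).
  assert (Ht : / (x + 1) <= t <= / x) by (apply ln_ratio_bounds; lra).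
  assert (Hx1 : 0 < / (x + 1)) by (apply Rinv_0_lt_compat; lra).
  assert (Hx0 : 0 < / x) by (apply Rinv_0_lt_compat; lra).
  pose proof (Cmod_shift_ge z x Hz Hx) as Hden.
  pose proof (Cmod_ge_0 z) as Hz0.
  assert (Hnz : (z + RtoC (x + 1))%C <> 0%C) by (apply Cmod_gt_0; lra).
  assert (Hxn : RtoC (x + 1) <> 0%C) by (intros E; apply RtoC_inj in E; lra).
  replace (Cexp (z * t) * RtoC (x + 1) / (z + RtoC (x + 1)) - 1)%C
    with (((Cexp (z * t) - 1 - z * t) + z * RtoC (t - / (x + 1)))
          * (RtoC (x + 1) / (z + RtoC (x + 1))))%C
    by (rewrite RtoC_minus, RtoC_inv by lra; field; auto).
  rewrite Cmod_mult, Cmod_div, Cmod_R, (Rabs_pos_eq (x + 1)) by (auto; lra).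
  assert (Hr : (x + 1) / Cmod (z + RtoC (x + 1)) <= 2) by (apply Rle_div_l; lra).
  assert (Hr0 : 0 <= (x + 1) / Cmod (z + RtoC (x + 1)))
    by (apply Rlt_le, Rdiv_lt_0_compat; lra).
  assert (Hw : Cmod (z * t) <= Cmod z * / x).
  { rewrite Cmod_mult, Cmod_R, Rabs_pos_eq by lra; apply Rmult_le_compat_l; lra. }
  assert (Hw2 : Cmod z * / x <= / 2).
  { apply Rmult_le_reg_r with x; [lra|].
    rewrite Rmult_assoc, Rinv_l by lra; lra. }
  assert (H1 : Cmod (Cexp (z * t) - 1 - z * t) <= 3 * (Cmod z ^ 2 * / x ^ 2)).
  { apply Rle_trans with (3 * Cmod (z * t) ^ 2); [apply Cexp_taylor1; lra|].
    apply Rmult_le_compat_l; [lra|].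
    rewrite <- pow_inv, <- Rpow_mult_distr.
    apply pow_incr; split; [apply Cmod_ge_0|exact Hw]. }
  assert (H2 : Cmod (z * RtoC (t - / (x + 1))) <= Cmod z * / x ^ 2).
  { rewrite Cmod_mult, Cmod_R, Rabs_pos_eq by lra.
    apply Rmult_le_compat_l; [lra|].
    apply Rle_trans with (/ x - / (x + 1)); [lra|].
    replace (/ x - / (x + 1)) with (/ (x * (x + 1))) by (field; lra).
    apply Rinv_le_contravar; simpl; nra. }
  set (D := Cmod (Cexp (z * t) - 1 - z * t + z * RtoC (t - / (x + 1)))).
  assert (HD : D <= (3 * Cmod z ^ 2 + Cmod z) * / x ^ 2)
    by (apply Rle_trans with (1 := Cmod_triangle _ _); lra).
  replace (2 * (3 * Cmod z ^ 2 + Cmod z) * / x ^ 2)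
    with ((3 * Cmod z ^ 2 + Cmod z) * / x ^ 2 * 2) by ring.
  apply Rmult_le_compat; auto; apply Cmod_ge_0.
Qed.

Lemma Cprod_neq_0 (f : nat -> C) (n : nat) :
  (forall j, (j < n)%nat -> f j <> 0%C) -> Cprod f n <> 0%C.
Proof.
  induction n as [|n IH]; intros H; simpl; [apply C1_nz|].
  apply Cmult_neq_0; auto.
Qed.

Lemma gauss_cv (z : C) :
  (forall j : nat, (z + INR j)%C <> 0%C) -> exists l, is_Clim (gauss z) l.
Proof.
  intros Hz.
  destruct (nfloor_ex (2 * Cmod z)) as [N0 [_ HN0]];
    [pose proof (Cmod_ge_0 z); lra|].
  (* Starting the sequence beyond [2|z|] makes [gauss_factor_bound] applicable; the second
     inequality gives the majorant in [1/(n+1)^2]. *)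
  assert (Hbase : forall n, 2 * Cmod z <= INR (n + S N0) /\ INR (S n) <= INR (n + S N0)).
  { intros n; split; [|apply le_INR; lia].
    rewrite plus_INR, S_INR; pose proof (pos_INR n); lra. }
  destruct (infinite_product_cv
    (fun n => gauss z (n + S N0))
    (fun n => Cexp (z * ln ((INR (n + S N0) + 1) / INR (n + S N0)))
              * RtoC (INR (n + S N0) + 1) / (z + RtoC (INR (n + S N0) + 1)) - 1)%C
    (fun n => 2 * (3 * Cmod z ^ 2 + Cmod z) * / powS 2 n)) as [l [H1 H2]].
  - intros n; set (M := (n + S N0)%nat); change (S n + S N0)%nat with (S M).
    assert (HM : 0 < INR M) by (apply lt_0_INR; unfold M; lia).
    unfold gauss.
    change (Cprod (fun j => z + INR j)%C (S (S M)))
      with (Cprod (fun j => z + INR j)%C (S M) * (z + INR (S M)))%C.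
    rewrite fact_simpl, mult_INR, RtoC_mult.
    pose proof (Hz (S M)) as HSM.
    rewrite S_INR in *; rewrite Rpow_C_ratio by easy.
    assert (Cprod (fun j => z + INR j)%C (S M) <> 0%C) by (apply Cprod_neq_0; auto).
    field; auto.
  - intros n; destruct (Hbase n) as [Ha Hb].
    assert (H1 : 1 <= INR (S n)) by (rewrite S_INR; pose proof (pos_INR n); lra).
    apply Rle_trans with (1 := gauss_factor_bound z _ Ha (Rle_trans _ _ _ H1 Hb)).
    apply Rmult_le_compat_l.
    + pose proof (Cmod_ge_0 z); pose proof (pow2_ge_0 (Cmod z)); lra.
    + apply Rinv_le_contravar; [apply powS_pos|].
      apply pow_incr; lra.
  - apply (ex_series_scal_l (K := R_AbsRing) (V := R_NormedModule) _
             (fun n => / powS 2 n)), ex_series_inv_pow; lia.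
  - exists l; split; now apply (is_lim_seq_incr_n _ (S N0)).
Qed.

Lemma Gamma_is_Clim (z : C) :
  (forall j : nat, (z + INR j)%C <> 0%C) -> is_Clim (gauss z) (Gamma z).
Proof.
  intros Hz; destruct (gauss_cv z Hz) as [l Hl].
  now replace (Gamma z) with l by (symmetry; apply is_Clim_unique, Hl).
Qed.

(** * Roots of unity *)

Lemma Cprod_ext (f g : nat -> C) (n : nat) :
  (forall j, (j < n)%nat -> f j = g j) -> Cprod f n = Cprod g n.
Proof.
  induction n as [|n IH]; intros H; simpl; [easy|].
  rewrite IH, H; auto.
Qed.

Lemma Cprod_mult (f g : nat -> C) (n : nat) :
  Cprod (fun j => f j * g j)%C n = (Cprod f n * Cprod g n)%C.
Proof. induction n as [|n IH]; simpl; [ring|rewrite IH; ring]. Qed.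

Lemma Cprod_div (f g : nat -> C) (n : nat) :
  (forall j, (j < n)%nat -> g j <> 0%C) ->
  Cprod (fun j => f j / g j)%C n = (Cprod f n / Cprod g n)%C.
Proof.
  induction n as [|n IH]; intros H; simpl; [field|].
  rewrite IH by auto.
  field; split; [auto|apply Cprod_neq_0; auto].
Qed.

Lemma Cprod_const (c : C) (n : nat) : Cprod (fun _ => c) n = (c ^ n)%C.
Proof. induction n as [|n IH]; simpl; [easy|rewrite IH; ring]. Qed.

Lemma Cprod_swap (f : nat -> nat -> C) (p n : nat) :
  Cprod (fun k => Cprod (f k) n) p = Cprod (fun j => Cprod (fun k => f k j) p) n.
Proof.
  induction p as [|p IH]; simpl.
  - rewrite Cprod_const, Cpow_1_l; easy.
  - now rewrite IH, Cprod_mult.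
Qed.

Lemma Cprod_RtoC (f : nat -> R) (n : nat) :
  Cprod (fun j => RtoC (f j)) n = RtoC (Rprod f n).
Proof. induction n as [|n IH]; simpl; [easy|now rewrite IH, RtoC_mult]. Qed.

Lemma Cprod_factor_neq_0 (f : nat -> C) (n j : nat) :
  Cprod f n <> 0%C -> (j < n)%nat -> f j <> 0%C.
Proof.
  induction n as [|n IH]; intros H Hj; [lia|]; simpl in H.
  destruct (Nat.eq_dec j n) as [->|Hn].
  - intros E; apply H; rewrite E; ring.
  - apply IH; [|lia]; intros E; apply H; rewrite E; ring.
Qed.

(* [f] is the function of a monic polynomial of degree [d], in Horner form. *)
Fixpoint monic (d : nat) (f : C -> C) : Prop :=
  match d with
  | O => forall x, f x = 1%C
  | S d => exists g a, monic d g /\ forall x, f x = (x * g x + a)%C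
  end.

(** Synthetic division: if [f = x g + a] and [g = (x - r) h + g(r)], the quotient is
    [x h + g(r)]. *)
Lemma monic_div (d : nat) (f : C -> C) (r : C) :
  monic (S d) f ->
  exists g, monic d g /\ forall x, f x = ((x - r) * g x + f r)%C.
Proof.
  revert f; induction d as [|d IH]; intros f [g [a [Hg Hf]]].
  - exists (fun _ => 1%C); split; [easy|].
    intros x; rewrite !Hf, !Hg; ring.
  - destruct (IH g Hg) as [h [Hh E]].
    exists (fun x => x * h x + g r)%C; split.
    + now exists h, (g r).
    + intros x; rewrite !Hf, (E x); ring.
Qed.

(** Divide by [x - r d]. The other [r i] stay roots of the quotient because [r i - r d] is nonzero,
    and being monic fixes the constant at the end. *)
Lemma monic_split (d : nat) (f : C -> C) (r : nat -> C) :
  monic d f ->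
  (forall i j, (i < j)%nat -> (j < d)%nat -> r i <> r j) ->
  (forall i, (i < d)%nat -> f (r i) = 0%C) ->
  forall x, f x = Cprod (fun k => x - r k)%C d.
Proof.
  revert f; induction d as [|d IH]; intros f Hm Hr H0 x; [apply Hm|].
  destruct (monic_div d f (r d) Hm) as [g [Hg E]].
  rewrite H0 in E by lia.
  simpl; rewrite <- (IH g), E; auto; [ring|].
  intros i Hi.
  assert (Hri : (r i - r d)%C <> 0%C) by (apply Cminus_eq_contra, Hr; lia).
  pose proof (E (r i)) as Ei; rewrite H0 in Ei by lia.
  replace (g (r i)) with (/ (r i - r d) * ((r i - r d) * g (r i) + 0))%C
    by (field; exact Hri).
  rewrite <- Ei; ring.
Qed.

Fixpoint Cgeom (m : nat) (x y : C) : C :=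
  match m with
  | O => 0%C
  | S p => (x * Cgeom p x y + y ^ p)%C
  end.

Lemma Cgeom_RtoC (m : nat) (x y : R) : Cgeom m x y = RtoC (geom m x y).
Proof.
  induction m as [|m IH]; [easy|].
  simpl; now rewrite IH, RtoC_plus, RtoC_mult, RtoC_pow.
Qed.

Lemma Cgeom_telescope (m : nat) (x y : C) :
  ((x - y) * Cgeom m x y)%C = (x ^ m - y ^ m)%C.
Proof.
  induction m as [|m IH]; simpl; [ring|].
  replace ((x - y) * (x * Cgeom m x y + y ^ m))%C
    with (x * ((x - y) * Cgeom m x y) + (x - y) * y ^ m)%C by ring.
  rewrite IH; ring.
Qed.

Lemma Cgeom_monic (m : nat) (y : C) : monic m (fun x => Cgeom (S m) x y).
Proof.
  induction m as [|m IH].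
  - intros x; simpl; ring.
  - exists (fun x => Cgeom (S m) x y), (y ^ S m)%C; now split.
Qed.

Lemma omega_pow (m k : nat) :
  (0 < m)%nat ->
  (omega m ^ k)%C
  = (cos (2 * PI * INR k / INR m), sin (2 * PI * INR k / INR m)).
Proof.
  intros Hm; unfold omega; rewrite Cexp_pow.
  assert (Hm' : INR m <> 0) by (apply not_0_INR; lia).
  replace (INR k * (2 * PI * Ci / INR m))%C with (0, 2 * PI * INR k / INR m).
  - unfold Cexp; simpl; rewrite exp_0.
    unfold Cmult, RtoC; simpl; f_equal; ring.
  - unfold Cdiv; rewrite <- RtoC_inv by easy.
    unfold Ci, Cmult, RtoC; simpl; f_equal; field; easy.
Qed.

Lemma omega_pow_m (m : nat) : (0 < m)%nat -> (omega m ^ m)%C = 1%C.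
Proof.
  intros Hm; rewrite omega_pow by easy.
  replace (2 * PI * INR m / INR m) with (2 * PI)
    by (field; apply not_0_INR; lia).
  now rewrite cos_2PI, sin_2PI.
Qed.

(** The angle is [2t] with [0 < t < PI], so its cosine [1 - 2 sin(t)^2] is less than 1. *)
Lemma omega_pow_neq_1 (m k : nat) :
  (0 < k)%nat -> (k < m)%nat -> (omega m ^ k)%C <> 1%C.
Proof.
  intros Hk Hkm; rewrite omega_pow by lia.
  intros E; injection E as E _.
  set (t := PI * INR k / INR m).
  assert (Hm : 0 < INR m) by (apply lt_0_INR; lia).
  replace (2 * PI * INR k / INR m) with (2 * t) in E by (unfold t; field; lra).
  rewrite cos_2a_sin in E.
  assert (H0 : 0 < t).
  { apply Rdiv_lt_0_compat; [|easy].
    apply Rmult_lt_0_compat; [apply PI_RGT_0|apply lt_0_INR; lia]. }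
  assert (H1 : t < PI).
  { apply Rlt_div_l; [easy|].
    apply Rmult_lt_compat_l; [apply PI_RGT_0|now apply lt_INR]. }
  pose proof (sin_gt_0 t H0 H1); nra.
Qed.

Lemma omega_neq_0 (m : nat) : (0 < m)%nat -> omega m <> 0%C.
Proof.
  intros Hm E; pose proof (omega_pow_m m Hm) as H.
  destruct m as [|m]; [lia|].
  rewrite Cpow_S, E, Cmult_0_l in H; now apply C1_nz.
Qed.

Lemma omega_pow_inj (m i j : nat) :
  (i < j)%nat -> (j - i < m)%nat -> (omega m ^ i)%C <> (omega m ^ j)%C.
Proof.
  intros Hij Hm E.
  apply (omega_pow_neq_1 m (j - i)); [lia|lia|].
  replace j with (i + (j - i))%nat in E by lia.
  rewrite Cpow_add_r in E.
  assert (Hi : (omega m ^ i)%C <> 0%C) by (apply Cpow_nz, omega_neq_0; lia).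
  replace (omega m ^ (j - i))%C
    with (/ omega m ^ i * (omega m ^ i * omega m ^ (j - i)))%C by (field; easy).
  rewrite <- E; field; easy.
Qed.

(** In [x] the left side is monic of degree [p], and it vanishes at [w^k y] for [0 < k <= p], since
    [(w^k y)^(p+1) = y^(p+1)] while [w^k y <> y]. The shift [k + 1] skips the root [y], which the
    quotient by [x - y] has removed. *)
Lemma Cgeom_split (p : nat) (x y : C) :
  y <> 0%C ->
  Cgeom (S p) x y = Cprod (fun k => x - omega (S p) ^ (k + 1) * y)%C p.
Proof.
  intros Hy.
  apply (monic_split p (fun x => Cgeom (S p) x y)
           (fun k => omega (S p) ^ (k + 1) * y)%C).
  - apply Cgeom_monic.
  - intros i j Hij Hj E.
    apply (omega_pow_inj (S p) (i + 1) (j + 1)); [lia|lia|].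
    transitivity (omega (S p) ^ (i + 1) * y / y)%C; [field; easy|].
    rewrite E; field; easy.
  - intros i Hi.
    set (w := (omega (S p) ^ (i + 1))%C).
    assert (Hw : (w * y - y)%C <> 0%C).
    { replace (w * y - y)%C with ((w - 1) * y)%C by ring.
      apply Cmult_neq_0; [|easy].
      apply Cminus_eq_contra, omega_pow_neq_1; lia. }
    assert (E : ((w * y - y) * Cgeom (S p) (w * y) y)%C = 0%C).
    { rewrite Cgeom_telescope, Cpow_mult_l.
      unfold w; rewrite <- Cpow_mult_r, Nat.mul_comm, Cpow_mult_r.
      rewrite omega_pow_m, Cpow_1_l by lia; ring. }
    transitivity (/ (w * y - y) * ((w * y - y) * Cgeom (S p) (w * y) y))%C;
      [field; easy|rewrite E; ring].
Qed.

(** * The product of the gamma factors *)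

(** The Horner recursion multiplies by [x] and adds 1; this form appends the top power, as [Cprod]
    appends its last factor. *)
Lemma Cgeom_1_succ (p : nat) (x : C) :
  Cgeom (S p) x 1 = (Cgeom p x 1 + x ^ p)%C.
Proof.
  induction p as [|p IH]; [simpl; ring|].
  change (Cgeom (S (S p)) x 1) with (x * Cgeom (S p) x 1 + 1 ^ S p)%C.
  rewrite IH at 1; rewrite !Cpow_1_l.
  change (Cgeom (S p) x 1) with (x * Cgeom p x 1 + 1 ^ p)%C.
  rewrite Cpow_1_l, Cpow_S; ring.
Qed.

(** The exponents add up, and [Cgeom (S p) w 1 - 1] is [w + ... + w^p]. *)
Lemma Cprod_Rpow_C (x : R) (w y : C) (p : nat) :
  Cprod (fun k => Rpow_C x (1 - w ^ (k + 1) * y))%C p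
  = Rpow_C x (INR p - (Cgeom (S p) w 1 - 1) * y).
Proof.
  unfold Rpow_C; induction p as [|p IH].
  - simpl; rewrite <- Cexp_0; f_equal; ring.
  - cbn [Cprod]; rewrite IH, <- Cexp_plus; f_equal.
    rewrite (Cgeom_1_succ (S p)), S_INR, RtoC_plus, Nat.add_1_r; ring.
Qed.

Lemma Rpow_C_INR (x : R) (n : nat) : 0 < x -> Rpow_C x (INR n) = RtoC (x ^ n).
Proof.
  intros Hx; unfold Rpow_C; rewrite <- RtoC_mult.
  rewrite <- Rpower_pow by easy; unfold Rpower, Cexp; simpl.
  rewrite cos_0, sin_0; unfold Cmult, RtoC; simpl; f_equal; ring.
Qed.

(** No gamma factor is taken at a pole: the number is a factor of
    [geom (S p) (INR (S j)) (INR (S n))], which is positive. *)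
Lemma omega_factor_neq_0 (p n k j : nat) :
  (k < p)%nat ->
  (1 - omega (S p) ^ (k + 1) * INR (S n) + INR j)%C <> 0%C.
Proof.
  intros Hk.
  assert (Hn : RtoC (INR (S n)) <> 0%C)
    by (intros E; apply RtoC_inj in E; now apply not_0_INR in E).
  replace (1 - omega (S p) ^ (k + 1) * INR (S n) + INR j)%C
    with (INR (S j) - omega (S p) ^ (k + 1) * INR (S n))%C
    by (rewrite (S_INR j), RtoC_plus; ring).
  apply (Cprod_factor_neq_0
           (fun k => INR (S j) - omega (S p) ^ (k + 1) * INR (S n))%C p); [|easy].
  rewrite <- Cgeom_split by easy; rewrite Cgeom_RtoC.
  intros E; apply RtoC_inj in E; revert E.
  apply Rgt_not_eq, geom_pos; apply lt_0_INR; lia.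
Qed.

(** The product is real at every finite [N]. All powers of [omega (S p)] sum to 0, so the exponents
    of [N] add up to [p + S n]. For each [j] the denominators multiply to a value of [geom] by
    [Cgeom_split]. *)
Lemma Cprod_gauss (p n N : nat) :
  (1 <= p)%nat -> (0 < N)%nat ->
  Cprod (fun k => gauss (1 - omega (S p) ^ (k + 1) * INR (S n)) N) p
  = RtoC (INR (fact N) ^ p * INR N ^ (p + S n)
          / Rprod (fun j => geom (S p) (INR (S j)) (INR (S n))) (S N)).
Proof.
  intros Hp HN; unfold gauss.
  assert (HN' : 0 < INR N) by now apply lt_0_INR.
  assert (Hn : RtoC (INR (S n)) <> 0%C)
    by (intros E; apply RtoC_inj in E; now apply not_0_INR in E).
  rewrite (Cprod_div (fun k => INR (fact N)
             * Rpow_C (INR N) (1 - omega (S p) ^ (k + 1) * INR (S n)))%C).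
  2:{ intros k Hk; apply Cprod_neq_0; intros j _; now apply omega_factor_neq_0. }
  rewrite Cprod_mult, Cprod_const, Cprod_Rpow_C, Cprod_swap.
  assert (E : Cgeom (S p) (omega (S p)) 1 = 0%C).
  { assert (H : (omega (S p) - 1)%C <> 0%C).
    { apply Cminus_eq_contra; rewrite <- (Cpow_1_r (omega (S p))).
      apply omega_pow_neq_1; lia. }
    transitivity (/ (omega (S p) - 1)
                  * ((omega (S p) - 1) * Cgeom (S p) (omega (S p)) 1))%C;
      [field; easy|].
    rewrite Cgeom_telescope, omega_pow_m, Cpow_1_l by lia; ring. }
  rewrite E.
  replace (INR p - (0 - 1) * INR (S n))%C with (RtoC (INR (p + S n)))
    by (rewrite plus_INR, RtoC_plus; ring).
  rewrite Rpow_C_INR by easy.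
  rewrite (Cprod_ext _ (fun j => RtoC (geom (S p) (INR (S j)) (INR (S n))))).
  2:{ intros j _; rewrite <- Cgeom_RtoC, Cgeom_split by easy.
      apply Cprod_ext; intros k _; rewrite (S_INR j), RtoC_plus; ring. }
  rewrite Cprod_RtoC, <- RtoC_pow, <- RtoC_mult, <- RtoC_div; [easy|].
  apply Rgt_not_eq, Rprod_pos; intros j _.
  apply geom_pos; apply lt_0_INR; lia.
Qed.

Lemma is_lim_seq_shift_ratio (c : R) :
  is_lim_seq (fun N => (INR N + c) / INR N) 1.
Proof.
  apply is_lim_seq_ext_loc with (fun N => 1 + c * / INR N).
  - exists 1%nat; intros N HN; field; apply not_0_INR; lia.
  - replace (Finite 1) with (Finite (1 + c * 0)) by (f_equal; ring).
    apply is_lim_seq_plus'; [apply is_lim_seq_const|].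
    apply is_lim_seq_mult'; [apply is_lim_seq_const|].
    apply (is_lim_seq_inv INR p_infty); [apply is_lim_seq_INR|easy].
Qed.

Lemma is_lim_seq_pow_1 (u : nat -> R) (p : nat) :
  is_lim_seq u 1 -> is_lim_seq (fun N => u N ^ p) 1.
Proof.
  intros Hu; induction p as [|p IH]; simpl; [apply is_lim_seq_const|].
  replace (Finite 1) with (Finite (1 * 1)) by (f_equal; ring).
  now apply is_lim_seq_mult'.
Qed.

(** The quotient of factorials has [k] factors [N + 1 - i], each equivalent to [N]. The recursion is
    claimed only for [N > k], where the truncated subtraction is exact. *)
Lemma is_lim_seq_falling_ratio (k : nat) :
  is_lim_seq (fun N => INR (fact (S N)) / (INR (fact (S N - k)) * INR N ^ k)) 1.
Proof.
  induction k as [|k IH].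
  - apply is_lim_seq_ext with (fun _ => 1); [|apply is_lim_seq_const].
    intros N; rewrite Nat.sub_0_r; change (INR N ^ 0) with 1.
    field; apply INR_fact_neq_0.
  - apply is_lim_seq_ext_loc with (fun N =>
      INR (fact (S N)) / (INR (fact (S N - k)) * INR N ^ k)
      * ((INR N + (1 - INR k)) / INR N)).
    + exists (S k); intros N HN.
      replace (S N - k)%nat with (S (S N - S k)) by lia.
      rewrite (fact_simpl (S N - S k)), mult_INR.
      assert (E : INR (S (S N - S k)) = INR N + (1 - INR k)).
      { replace (S (S N - S k)) with (S N - k)%nat by lia.
        rewrite minus_INR, S_INR by lia; ring. }
      assert (INR (S (S N - S k)) <> 0) by (apply not_0_INR; lia).
      assert (INR N <> 0) by (apply not_0_INR; lia).
      rewrite <- E, <- (tech_pow_Rmult (INR N) k).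
      field; repeat split; auto using INR_fact_neq_0, pow_nonzero.
    + replace (Finite 1) with (Finite (1 * 1)) by (f_equal; ring).
      apply is_lim_seq_mult'; [exact IH|apply is_lim_seq_shift_ratio].
Qed.

(** An exact identity at finite [N]. Both sides contain the same product of [geom] over [N + 1]
    indices. What remains is [(N+1)!^p] against [N!^p N^p], and the falling factorial against
    [N^(n+1)]; the last factor collects both ratios. *)
Lemma residue_gauss (p n N : nat) :
  (1 <= p)%nat -> (0 < N)%nat -> (n <= N)%nat ->
  RtoC (residue (powS (S p)) n (S N))
  = (RtoC (INR (S p) * (-1) ^ n / INR (fact (S n)))
     * Cprod (fun k => gauss (1 - omega (S p) ^ (k + 1) * INR (S n)) N) p
     * RtoC (((INR N + 1) / INR N) ^ p
             * (INR (fact (S N)) / (INR (fact (S N - S n)) * INR N ^ S n))))%C.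
Proof.
  intros Hp HN HnN; rewrite Cprod_gauss, <- !RtoC_mult by easy; f_equal.
  replace (S N) with (S n + (N - n))%nat at 1 by lia.
  rewrite residue_powS; replace (S n + (N - n))%nat with (S N) by lia.
  replace (N - n)%nat with (S N - S n)%nat by lia.
  set (P := Rprod _ _).
  assert (HP : P <> 0).
  { apply Rgt_not_eq, Rprod_pos; intros j _; apply geom_pos; apply lt_0_INR; lia. }
  assert (HN' : INR N <> 0) by (apply not_0_INR; lia).
  unfold Rdiv at 5; rewrite Rpow_mult_distr, pow_inv, pow_add.
  rewrite (fact_simpl N), mult_INR, (Rpow_mult_distr (INR (S N))), (S_INR N).
  field; repeat split; auto using INR_fact_neq_0, pow_nonzero.
Qed.

Lemma residue_cv (p n : nat) :
  (1 <= p)%nat ->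
  is_Clim (fun N => RtoC (residue (powS (S p)) n (S N)))
    (RtoC (INR (S p) * (-1) ^ n / INR (fact (S n)))
     * Cprod (fun k => Gamma (1 - omega (S p) ^ (k + 1) * INR (S n))) p)%C.
Proof.
  intros Hp.
  set (c := RtoC (INR (S p) * (-1) ^ n / INR (fact (S n)))).
  (* The factor [1 * 1] is the limit of the two correction ratios in [residue_gauss]. *)
  replace (c * _)%C
    with (c * Cprod (fun k => Gamma (1 - omega (S p) ^ (k + 1) * INR (S n))) p
          * RtoC (1 * 1))%C by (rewrite Rmult_1_l; ring).
  eapply is_Clim_ext_loc; cycle 1.
  - apply is_Clim_mult; [apply is_Clim_mult; [apply is_Clim_const|]|].
    + apply (is_Clim_Cprod
               (fun k => gauss (1 - omega (S p) ^ (k + 1) * INR (S n)))).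
      intros k Hk; apply Gamma_is_Clim; intros j; now apply omega_factor_neq_0.
    + apply is_Clim_RtoC, is_lim_seq_mult'.
      * apply is_lim_seq_pow_1, is_lim_seq_shift_ratio.
      * apply (is_lim_seq_falling_ratio (S n)).
  - exists (S n); intros N HN; symmetry; apply residue_gauss; lia.
Qed.

(** * From real to complex series, and the conclusion *)

Lemma sum_n_RtoC (a : nat -> R) (N : nat) :
  sum_n (G := C_AbelianMonoid) (fun n => RtoC (a n)) N = RtoC (sum_n a N).
Proof.
  induction N as [|N IH]; [now rewrite !sum_O|].
  now rewrite sum_Sn, IH, sum_n_succ, RtoC_plus.
Qed.

Lemma is_series_RtoC (a : nat -> R) (l : R) :
  is_series a l ->
  is_series (K := C_AbsRing) (V := C_NormedModule) (fun n => RtoC (a n)) (RtoC l).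
Proof.
  intros H; unfold is_series.
  apply filterlim_ext with (fun N => RtoC (sum_n a N));
    [intros; symmetry; apply sum_n_RtoC|].
  apply filterlim_locally; intros eps.
  apply (filter_imp (fun N => ball l eps (sum_n a N))).
  - intros N HN; split; [exact HN|apply ball_center].
  - exact (proj1 (filterlim_locally _ _) H eps).
Qed.

Lemma zeta_INR (m : nat) :
  (2 <= m)%nat -> zeta (INR m) = RtoC (Series (fun j => / powS m j)).
Proof.
  intros Hm; apply is_Clim_unique.
  apply is_Clim_ext_loc with (fun N => RtoC (sum_n (fun j => / powS m j) N)).
  - exists 0%nat; intros N _; rewrite <- sum_n_RtoC.
    apply (sum_n_ext (G := C_AbelianMonoid)); intros i.
    change (RtoC (/ powS m i) = Rpow_C (INR (S i)) (- INR m) :> C).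
    assert (Hi : 0 < INR (S i)) by (apply lt_0_INR; lia).
    assert (Hp : RtoC (powS m i) <> 0%C)
      by (intros E; apply RtoC_inj in E; pose proof (powS_pos m i); lra).
    (* The complex power with exponent [-m] is recognised as an inverse because the exponents [-m]
       and [m] add to 0. *)
    assert (E : (Rpow_C (INR (S i)) (- INR m) * RtoC (powS m i))%C = 1%C).
    { unfold powS; rewrite <- Rpow_C_INR by easy.
      unfold Rpow_C; rewrite <- Cexp_plus, <- Cexp_0; f_equal; ring. }
    rewrite RtoC_inv by (intros E'; apply Hp; now rewrite E').
    transitivity (Rpow_C (INR (S i)) (- INR m) * RtoC (powS m i) / RtoC (powS m i))%C;
      [rewrite E; field; easy|field; easy].
  - apply is_Clim_RtoC, (Series_correct (fun j => / powS m j)), ex_series_inv_pow, Hm.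
Qed.

Theorem theorem1 (m : nat) (hm : (2 <= m)%nat) :
  is_series (K := C_AbsRing) (V := C_NormedModule)
    (fun i : nat =>
       let n := S i in
       (INR m * (-1) ^ (n - 1)
        * Cprod (fun k => Gamma (1 - omega m ^ (k + 1) * INR n)) (m - 1)
        / (INR (fact n) * INR n ^ m))%C)
    (zeta (INR m)).
Proof.
  destruct m as [|p]; [lia|].
  set (W := fun n => (RtoC (INR (S p) * (-1) ^ n / INR (fact (S n)))
     * Cprod (fun k => Gamma (1 - omega (S p) ^ (k + 1) * INR (S n))) p)%C).
  assert (HW : forall n, is_Clim (fun N => RtoC (residue (powS (S p)) n (S N))) (W n))
    by (intros n; apply residue_cv; lia).
  (* Since [W n] is real, the real statement [series_residue] yields the complex series. *)
  assert (WR : forall n, W n = RtoC (Re (W n))).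
  { intros n; exact (is_Clim_real _ _ (HW n)). }
  rewrite zeta_INR by easy.
  eapply is_series_ext; cycle 1.
  - apply is_series_RtoC, (series_residue (S p) (fun n => Re (W n)) hm).
    intros n; exact (proj1 (HW n)).
  - intros n; cbv zeta beta.
    assert (Hf : RtoC (INR (fact (S n))) <> 0%C)
      by (intros E; apply RtoC_inj in E; now apply INR_fact_neq_0 in E).
    assert (Hn : RtoC (INR (S n)) <> 0%C)
      by (intros E; apply RtoC_inj in E; now apply not_0_INR in E).
    rewrite RtoC_div by (apply Rgt_not_eq, powS_pos).
    rewrite <- WR; unfold W, powS.
    rewrite RtoC_div, RtoC_mult, !RtoC_pow by apply INR_fact_neq_0.
    replace (S p - 1)%nat with p by lia; replace (S n - 1)%nat with n by lia.
    match goal with |- ?x = ?y => change (x = y :> C) end.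
    field; split; [now apply Cpow_nz|easy].
Qed.
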